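(* There exist a constant $c>0$ and a class $\mathcal{C}$ of CNF formulas, containing formulas of arbitrarily large size, such that $\mathsf{DNNF}(F) \geq 2^{c\cdot \mathsf{size}(F)}$ for every $F \in \mathcal{C}$. Moreover, every formula in $\mathcal{C}$ is a read $3$ times monotone $2$-CNF.
   Context: Fix a countable set $X$ of variables; an assignment is a function $f\colon X\to\{0,1\}$. An NNF (negation normal form) $C$ is a finite directed acyclic graph whose nodes (gates) are labelled and whose arcs are called wires, with a unique sink (the output gate); source nodes (input gates) are labelled by $0$, $1$, $x$ or $\neg x$ with $x\in X$, and non-source nodes are labelled $\wedge$ or $\vee$. $\mathsf{vars}(C)$ is the set of variables occurring in labels of input gates. The size $\mathsf{size}(C)$ is the number of wires. The value $C(f)$ under an assignment $f$ is defined as usual; two NNFs $C,C'$ are equivalent if $C(f)=C'(f)$ for all assignments $f$. For a gate $v$, $\mathsf{sub}(C,v)$ is the NNF consisting of $v$ and all gates with a directed path to $v$, with the wires among them and the same labels. A DNNF is an NNF $D$ such that for every $\wedge$-gate with input wires from gates $v_1,\dots,v_i$, the sets $\mathsf{vars}(\mathsf{sub}(D,v_j))$, $j=1,\dots,i$, are pairwise disjoint. A CNF is a finite conjunction of clauses (finite disjunctions of literals), viewed as an NNF with one $\wedge$ output gate, one $\vee$-gate per clause wired to the output, and wires from input gates labelled by the literals of the clause into the clause's $\vee$-gate; thus $\mathsf{size}(F)=\sum_{\text{clauses } K \text{ of } F}(|K|+1)$. For a CNF $F$, $\mathsf{DNNF}(F)$ is the minimum size of a DNNF equivalent to $F$.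 A CNF is monotone if it contains no negated literal, a $2$-CNF if every clause has at most $2$ literals, and read $3$ times if every variable has at most $3$ occurrences in $F$. *)

(* Defs.v *)
(* MathComp / MathComp-Analysis *)
From mathcomp Require Import all_boot all_order all_algebra finmap.
From mathcomp Require Import boolp reals exp.

Set Implicit Arguments.
Unset Strict Implicit.
Unset Printing Implicit Defensive.

Variant label (X : Type) : Type :=
  | Const of bool
  | Lit of X & bool (* [Lit x true] is x, [Lit x false] is its negation *)
  | And
  | Or.
Arguments Const {X} b.
Arguments And {X}.
Arguments Or {X}.

Definition is_input X (l : label X) : bool :=
  match l with Const _ | Lit _ _ => true | And | Or => false end.

Definition is_and X (l : label X) : bool :=
  if l is And then true else false.

Definition label_var X (l : label X) : option X :=
  if l is Lit x _ then Some x else None.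

(* [wire u v] is the arc from u to v.  In particular a source is never labelled
   And or Or: there are no gates of fan-in 0. *)
Record nnf (X : Type) : Type := NNF {
  gate : finType;
  wire : rel gate;
  gate_label : gate -> label X;
  output : gate;
  wire_acyclic : forall u v, wire u v -> ~~ connect wire v u;
  output_sink : forall v, [forall u, ~~ wire v u] = (v == output);
  input_source : forall v, is_input (gate_label v) = [forall u, ~~ wire u v]
}.

Section Semantics.
Variable X : Type.
Implicit Types (C : nnf X) (f : X -> bool).

(* The recursion follows wires backwards; #|gate C| levels suffice because C is
   acyclic, see [gate_valueE]. *)
Fixpoint gate_value_rec C f (n : nat) (v : gate C) : bool :=
  match gate_label v with
  | Const b => b
  | Lit x b => f x == b
  | And => if n is m.+1 then [forall (u | wire u v), gate_value_rec f m u]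
           else true
  | Or => if n is m.+1 then [exists (u | wire u v), gate_value_rec f m u]
          else false
  end.

Definition gate_value C f (v : gate C) : bool := gate_value_rec f #|gate C| v.

Definition value C f : bool := gate_value f (output C).

Definition equivalent C C' : Prop := forall f, value C f = value C' f.

Definition nnf_size C : nat := #|[pred p : gate C * gate C | wire p.1 p.2]|.

Lemma gate_value_rec_stable C f n m (v : gate C) :
    #|[pred u | connect (@wire _ C) u v]| <= n ->
    #|[pred u | connect (@wire _ C) u v]| <= m ->
  gate_value_rec f n v = gate_value_rec f m v.
Proof.
have ltv (u w : gate C) : wire u w ->
    #|[pred t | connect (@wire _ C) t u]|
    < #|[pred t | connect (@wire _ C) t w]|.
  move=> uw; apply: proper_card; apply/properP; split.
    by apply/subsetP => t; rewrite !inE => tu;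
       apply: connect_trans tu (connect1 uw).
  by exists w; rewrite !inE ?connect0 ?wire_acyclic.
have pos (w : gate C) : 0 < #|[pred t | connect (@wire _ C) t w]|.
  by apply/card_gt0P; exists w; rewrite inE connect0.
elim: n m v => [|n IHn] [|m] v hn hm.
- by [].
- by have := pos v; rewrite ltnNge hn.
- by have := pos v; rewrite ltnNge hm.
have eq u : wire u v -> gate_value_rec f n u = gate_value_rec f m u.
  by move=> uv; apply: IHn; rewrite -ltnS; apply: leq_trans (ltv _ _ uv) _.
rewrite /=; case: (gate_label v) => //.
  apply: eq_forallb => u; case uv: (wire u v) => //=; exact: eq.
apply: eq_existsb => u; case uv: (wire u v) => //=; exact: eq.
Qed.

Lemma gate_valueE C f (v : gate C) :
  gate_value f v =
  match gate_label v with
  | Const b => b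
  | Lit x b => f x == b
  | And => [forall (u | wire u v), gate_value f u]
  | Or => [exists (u | wire u v), gate_value f u]
  end.
Proof.
rewrite {1}/gate_value.
rewrite (@gate_value_rec_stable C f #|gate C| #|gate C|.+1 v) ?max_card //.
by rewrite (leq_trans (max_card _)).
Qed.

Lemma acyclic_rank (T : finType) (e : rel T) (rk : T -> nat) :
  (forall u v, e u v -> rk u < rk v) -> forall u v, e u v -> ~~ connect e v u.
Proof.
move=> rkP u v uv; apply/negP => /connectP[p].
have le (w : T) q : path e w q -> rk w <= rk (last w q).
  elim: q w => [|z q IHq] w //= /andP[wz /IHq]; apply: leq_trans.
  exact: ltnW (rkP _ _ wz).
by move=> /le + eu; rewrite -eu leqNgt rkP.
Qed.

End Semantics.

Section Decomposable.
Variable X : eqType.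
Implicit Types (C : nnf X) (f : X -> bool).

Definition vars C : seq X := pmap (fun v => label_var (gate_label v)) (enum (gate C)).

Definition sub_gate C (v : gate C) : finType :=
  {u : gate C | connect (@wire _ C) u v}.

Definition sub_wire C (v : gate C) : rel (sub_gate v) :=
  fun u w => wire (val u) (val w).

Lemma sub_acyclic C (v : gate C) (u w : sub_gate v) :
  sub_wire u w -> ~~ connect (@sub_wire C v) w u.
Proof.
move=> /wire_acyclic; apply: contra => /connectP[p pp ->].
apply/connectP; exists (map val p); last by rewrite last_map.
by rewrite path_map.
Qed.

Lemma sub_output_sink C (v : gate C) (u : sub_gate v) :
  [forall w, ~~ sub_wire u w] = (u == exist _ v (connect0 _ v)).
Proof.
apply/forallP/eqP => [sinku | -> [w wv]].
  apply/val_inj => /=; case: u sinku => u /= uv sinku.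
  have /connectP[[|w p]] := uv; first by move=> _ ->.
  move=> /= /andP[uw wp] ev.
  have wv : connect (@wire _ C) w v by apply/connectP; exists p.
  by have := sinku (exist _ w wv); rewrite /sub_wire /= uw.
by apply/negP; rewrite /sub_wire /= => /wire_acyclic; rewrite wv.
Qed.

Lemma sub_input_source C (v : gate C) (w : sub_gate v) :
  is_input (gate_label (val w)) = [forall u, ~~ sub_wire u w].
Proof.
rewrite input_source; apply/forallP/forallP => [h u|h u]; first exact: h.
apply/negP => uw.
have uv : connect (@wire _ C) u v := connect_trans (connect1 uw) (valP w).
by have := h (exist _ u uv); rewrite /sub_wire /= uw.
Qed.

Definition sub C (v : gate C) : nnf X :=
  NNF (@sub_acyclic C v) (@sub_output_sink C v) (@sub_input_source C v).

Definition is_dnnf C : Prop :=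
  forall v : gate C, is_and (gate_label v) ->
  forall u w : gate C, wire u v -> wire w v -> u != w ->
  ~~ has [in vars (sub u)] (vars (sub w)).

Lemma mem_vars C (x : X) :
  reflect (exists v : gate C, label_var (gate_label v) = Some x) (x \in vars C).
Proof.
rewrite /vars mem_pmap; apply: (iffP mapP) => [[v _ ->]|[v <-]].
  by exists v.
by exists v; rewrite // mem_enum.
Qed.

Lemma mem_vars_sub C (v : gate C) (x : X) :
  reflect (exists2 u : gate C, connect (@wire _ C) u v &
             label_var (gate_label u) = Some x)
          (x \in vars (sub v)).
Proof.
apply: (iffP (mem_vars _ _)) => [[[u uv] /= h]|[u uv h]]; first by exists u.
by exists (exist _ u uv).
Qed.

Lemma eq_value C f g : {in vars C, f =1 g} -> value C f = value C g.
Proof.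
move=> fg; rewrite /value /gate_value; move: #|_| (output C) => n.
elim: n => [|n IHn] v /=; case E: (gate_label v) => [|x b||] //.
- by rewrite fg //; apply/mem_vars; exists v; rewrite E.
- by rewrite fg //; apply/mem_vars; exists v; rewrite E.
- by apply: eq_forallb => u; rewrite IHn.
- by apply: eq_existsb => u; rewrite IHn.
Qed.

End Decomposable.

(* Every NNF has an equivalent DNNF: the disjunction of 0 and of one conjunction
   per satisfying assignment of the variables of C; the constants 0 and 1 are
   only there to avoid gates of fan-in 0. *)
Section Existence.
Variable X : countType.
Variable C : nnf X.

Let V : finType := seq_sub (vars C).

Definition minterm_assign (m : {ffun V -> bool}) (x : X) : bool :=
  if insub x is Some y then m y else false.

Let M : finType := {m : {ffun V -> bool} | value C (minterm_assign m)}.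

(* output; constant 0; for each m, the conjunction, constant 1 and literals *)
Definition minterm_gate : finType := (bool + M * option (option V))%type.

Definition minterm_wire : rel minterm_gate := fun u v =>
  match u, v with
  | inl false, inl true => true
  | inr (_, None), inl true => true
  | inr (m, Some _), inr (m', None) => m == m'
  | _, _ => false
  end.

Definition minterm_label (u : minterm_gate) : label X :=
  match u with
  | inl true => Or
  | inl false => Const false
  | inr (_, None) => And
  | inr (_, Some None) => Const true
  | inr (m, Some (Some y)) => Lit (val y) (val m y)
  end.

Lemma minterm_acyclic u v : minterm_wire u v -> ~~ connect minterm_wire v u.
Proof.
apply: (@acyclic_rank _ _ (fun u : minterm_gate => match u with
   | inl true => 2 | inr (_, None) => 1 | _ => 0 end)).
by move=> [[]|[m [[y|]|]]] [[]|[m' [[y'|]|]]].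
Qed.

Lemma minterm_output v :
  [forall u, ~~ minterm_wire v u] = (v == inl true).
Proof.
apply/forallP/eqP => [h|-> [[]|[m [[y|]|]]]] //.
case: v h => [[]|[m [o|]]] // h.
- by have := h (inl true).
- by have := h (inr (m, None)); rewrite /= eqxx.
- by have := h (inl true).
Qed.

Lemma minterm_input v :
  is_input (minterm_label v) = [forall u, ~~ minterm_wire u v].
Proof.
apply/esym; case: v => [[]|[m [[y|]|]]] /=.
- by apply/forallP => /(_ (inl false)).
- by apply/forallP => -[[]|[m' [[y'|]|]]].
- by apply/forallP => -[[]|[m' [[y'|]|]]].
- by apply/forallP => -[[]|[m' [[y'|]|]]].
- by apply/forallP => /(_ (inr (m, Some None))); rewrite /= eqxx.
Qed.

Definition minterm_nnf : nnf X :=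
  NNF minterm_acyclic minterm_output minterm_input.

Lemma minterm_dnnf : is_dnnf minterm_nnf.
Proof.
have src m o w : connect minterm_wire w (inr (m, Some o)) ->
    w = inr (m, Some o).
  move=> /connectP[p]; elim/last_ind: p => [_ ->//|p z _].
  rewrite rcons_path last_rcons => /andP[_ + e]; rewrite -e.
  by case: (last w p) => [[]|[m' [[y'|]|]]].
move=> [[]|[m [[y|]|]]] //= _ [[]|[m1 [o1|]]] // [[]|[m2 [o2|]]] //=.
move=> /eqP e1 /eqP e2; subst m1 m2 => ne; apply/hasPn => x.
move=> /mem_vars_sub[u2 /src-> h2]; apply/negP => /mem_vars_sub[u1 /src-> h1].
case: o1 o2 h1 h2 ne => [y1|] [y2|] //= [e1] [e2].
by rewrite (val_inj (etrans e1 (esym e2))) eqxx.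
Qed.

Lemma minterm_equiv : equivalent minterm_nnf C.
Proof.
move=> f; rewrite {1}/value gate_valueE /=.
apply/existsP/idP.
  move=> [[[]|[m [[y|]|]]]] //=; first by rewrite gate_valueE.
  rewrite gate_valueE /= => /forallP h.
  rewrite (@eq_value X C f (minterm_assign (val m))) ?(valP m) //.
  move=> x xC; pose y : V := Sub x xC.
  have := h (inr (m, Some (Some y))); rewrite /= eqxx gate_valueE /=.
  by rewrite /minterm_assign insubT => /eqP.
move=> Cf; pose m0 : {ffun V -> bool} := [ffun y => f (val y)].
have hm0 : value C (minterm_assign m0).
  rewrite -(@eq_value X C f) // => x xC.
  by rewrite /minterm_assign insubT ffunE.
exists (inr (exist _ m0 hm0, None)); rewrite /= gate_valueE /=.
apply/forallP => -[[]|[m [[y|]|]]] //=; apply/implyP => /eqP->;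
  by rewrite gate_valueE //= ffunE.
Qed.

Lemma dnnf_exists : exists n,
  `[< exists D : nnf X, [/\ is_dnnf D, equivalent D C & nnf_size D = n] >].
Proof.
exists (nnf_size minterm_nnf); apply/asboolP.
by exists minterm_nnf; split; [exact: minterm_dnnf|exact: minterm_equiv|].
Qed.

Definition DNNF : nat := ex_minn dnnf_exists.

End Existence.

Lemma DNNF_attained (X : countType) (C : nnf X) :
  exists D : nnf X, [/\ is_dnnf D, equivalent D C & nnf_size D = DNNF C].
Proof. by rewrite /DNNF; case: ex_minnP => n /asboolP. Qed.

Lemma DNNF_min (X : countType) (C D : nnf X) :
  is_dnnf D -> equivalent D C -> DNNF C <= nnf_size D.
Proof.
rewrite /DNNF; case: ex_minnP => n _ min dD eD.
by apply: min; apply/asboolP; exists D.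
Qed.

Local Open Scope fset_scope.
Local Open Scope nat_scope.

(* A clause is a set of literals: [(x, true)] is the literal x and [(x, false)] its
   negation.  The two conditions exclude the degenerate formulas whose And- or Or-gates
   would have fan-in 0, and which are therefore not NNFs. *)
Record cnf (X : countType) : Type := CNF {
  clauses :> {fset {fset X * bool}};
  cnf_neq0 : clauses != fset0;
  clause_neq0 : fset0 \notin clauses
}.

Section CNF.
Variable X : countType.
Implicit Type F : cnf X.

(* the output; one gate per clause; one input gate per literal of each clause *)
Definition cnf_gate F : finType :=
  (unit + (F : {fset _}) + {K : (F : {fset _}) & (val K : {fset _})})%type.

Definition cnf_wire F : rel (cnf_gate F) := fun u v =>
  match u, v with
  | inl (inr _), inl (inl _) => true
  | inr l, inl (inr K) => tag l == K
  | _, _ => false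
  end.

Definition cnf_label F (u : cnf_gate F) : label X :=
  match u with
  | inl (inl _) => And
  | inl (inr _) => Or
  | inr l => Lit (val (tagged l)).1 (val (tagged l)).2
  end.

Lemma cnf_acyclic F u v : @cnf_wire F u v -> ~~ connect (@cnf_wire F) v u.
Proof.
apply: (@acyclic_rank _ _ (fun u : cnf_gate F => match u with
   | inl (inl _) => 2 | inl (inr _) => 1 | inr _ => 0 end)).
by move=> [[[]|K]|l] [[[]|K']|l'].
Qed.

Lemma cnf_output F v :
  [forall u, ~~ @cnf_wire F v u] = (v == inl (inl tt)).
Proof.
apply/forallP/eqP => [h|-> [[[]|K]|l]] //.
case: v h => [[[]|K]|l] // h.
- by have := h (inl (inl tt)).
- by have := h (inl (inr (tag l))); rewrite /= eqxx.
Qed.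

Lemma cnf_input F v :
  is_input (cnf_label v) = [forall u, ~~ @cnf_wire F u v].
Proof.
apply/esym; case: v => [[[]|K]|l] /=.
- have /fset0Pn[K KF] := cnf_neq0 F.
  by apply/forallP => /(_ (inl (inr [` KF])))%fset.
- have /fset0Pn[l lK] : val K != fset0.
    by apply: contraNneq (clause_neq0 F) => <-; exact: valP.
  apply/forallP => /(_ (inr (Tagged (fun K : (F : {fset _}) => (val K : {fset _})) [` lK]))).
  by rewrite /= eqxx.
- by apply/forallP => -[[[]|K]|l'].
Qed.

Definition cnf_nnf F : nnf X := NNF (@cnf_acyclic F) (@cnf_output F) (@cnf_input F).

Lemma cnf_sizeE F : nnf_size (cnf_nnf F) = \sum_(K <- clauses F) (#|` K| + 1).
Proof.
have -> : nnf_size (cnf_nnf F) =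
    \sum_(u : cnf_gate F) \sum_(v | cnf_wire u v) 1.
  by rewrite pair_big_dep /= sum1_card.
rewrite !big_sumType /=.
have -> : \sum_(i : unit) \sum_(v : cnf_gate F | false) 1 = 0.
  by rewrite big1 // => i _; rewrite big_pred0.
rewrite add0n (eq_bigr (fun=> 1)) => [|K _]; last first.
  by rewrite (big_pred1 (inl (inl tt))) // => -[[[]|K']|l].
rewrite [X in _ + X](eq_bigr (fun=> 1)) => [|l _]; last first.
  rewrite (big_pred1 (inl (inr (tag l)))) // => -[[[]|K']|l'] //=.
  by rewrite eq_sym.
rewrite [X in _ + X]sum1_card card_tagged sumnE big_map big_enum /=.
rewrite -big_split /= [RHS]big_seq_fsetE /=.
by apply: eq_bigr => K _; rewrite addnC cardfE.
Qed.

Lemma cnf_valueE F f :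
  value (cnf_nnf F) f =
  [forall K : (F : {fset _}),
     exists l : (val K : {fset _}), f (val l).1 == (val l).2].
Proof.
rewrite /value gate_valueE /=; apply/forallP/forallP => h.
  move=> K; have := h (inl (inr K)); rewrite gate_valueE /=.
  move=> /existsP[[[[]|K']|[K' l]]] //= /andP[/eqP e]; subst K'.
  by rewrite gate_valueE /= => fl; apply/existsP; exists l.
move=> [[[]|K]|l] //=; rewrite gate_valueE /=.
have /existsP[l fl] := h K; apply/existsP.
exists (inr (Tagged (fun K : (F : {fset _}) => (val K : {fset _})) l)).
by rewrite /= eqxx gate_valueE.
Qed.

Definition monotone F : Prop :=
  forall K : {fset X * bool}, K \in clauses F ->
  forall l : X * bool, l \in K -> l.2 = true.

Definition is_kcnf (k : nat) F : Prop :=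
  forall K : {fset X * bool}, K \in clauses F -> #|` K| <= k.

Definition occurrences F (x : X) : nat :=
  \sum_(K <- clauses F) #|` [fset l in K | l.1 == x]|.

Definition read_times (k : nat) F : Prop := forall x : X, occurrences F x <= k.

End CNF.

Coercion cnf_nnf : cnf >-> nnf.

(* Main.v *)
Require Import Defs.
From mathcomp Require Import all_fingroup zify.
From mathcomp Require Import all_boot all_order all_algebra finmap.
From mathcomp Require Import boolp reals exp.

(* The formula is the vertex cover formula of a bipartite graph on two copies of
   an n-element set, the union of the perfect matchings given by 1 and two
   permutations.  Counting shows that for suitable permutations every cut that
   is balanced on the left side is crossed by linearly many edges of one of the
   three matchings.

   A wire (u, v) of a DNNF D determines the set of models of D that make u and v
   true and reach the output from v; if u and v straddle the weight 2n/3 (v and all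
   its inputs, when v is a conjunction), this set is closed under mixing along a
   balanced partition of the variables, and these size(D) rectangles cover all models.  Mixing forces, for each edge
   crossing the partition, one endpoint to be constantly true on the rectangle.

   To count, choose a random set b of vertices and take the independent set of
   those v in b with no neighbour in b.  Among linearly many prescribed vertices,
   linearly many have disjoint closed neighbourhoods, and these independently belong to this set with
   probability at least 1/16; so each rectangle captures an exponentially small
   fraction of the sets b. *)

Set Implicit Arguments.
Unset Strict Implicit.
Unset Printing Implicit Defensive.
Import Order.TTheory GRing.Theory Num.Theory.
Local Open Scope nat_scope.

(** * Expanding permutations *)

(** Lowering both arguments by one divides the binomial by [n.+1 / a.+1], and this ratio is at least
    2 as long as the lower argument is at most half the upper. *)
Lemma leq_exp2_bin n a : a.*2 <= n -> 2 ^ a <= 'C(n, a).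
Proof.
elim: a n => [|a IH] [|n] // h; rewrite ?bin0 //.
have e := mul_bin_diag n.+1 a; rewrite /= in e.
have IHn : 2 ^ a <= 'C(n, a) by apply: IH; lia.
have : 2 * 'C(n, a) <= 'C(n.+1, a.+1) by nia.
rewrite expnS; lia.
Qed.

(** An integer form of [(1 + 1/q)^q <= 4] for [q = 2j]: Bernoulli applied to [(1 - 1/(q+1))^j] gives
    [(1 + 1/q)^j <= (2j+1)/(j+1) <= 2], which is then squared. *)
Lemma expnS_leq j : (j.*2).+1 ^ j.*2 <= 4 * j.*2 ^ j.*2.
Proof.
have bernoulli q i : (q.+1 - i) * q.+1 ^ i <= q.+1 * q ^ i.
  elim: i => [|i IH]; first by rewrite subn0.
  have : (q.+1 - i.+1) * q.+1 <= q * (q.+1 - i) by nia.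
  rewrite !expnS => h; have := leq_mul h (leqnn (q.+1 ^ i)); nia.
suff: (j.*2).+1 ^ j <= 2 * j.*2 ^ j.
  move=> h; have := leq_mul h h.
  by rewrite -expnD addnn mulnACA -expnD addnn.
have := bernoulli j.*2 j; set x := _ ^ j; set y := _ ^ j => h.
have : j.+1 * x <= (j.*2).+1 * y by apply: leq_trans h; nia.
nia.
Qed.

Lemma leq_card_bigcup (I T : finType) (P : pred I) (F : I -> {set T}) :
  #|\bigcup_(i | P i) F i| <= \sum_(i | P i) #|F i|.
Proof.
elim/big_rec2: _ => [|i m A _ IH]; first by rewrite cards0.
by apply: leq_trans (leq_card_setU _ _) _; rewrite leq_add2l.
Qed.

Section Expander.
Variable T : finType.
Implicit Types (p : {perm T}) (A C D : {set T}).

Definition displaced p A : {set T} := [set i | (i \in A) != (p i \in A)].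

(** List each set followed by its complement, and match the two lists position by position. *)
Lemma exists_perm_preim A C : #|A| = #|C| -> exists p : {perm T}, p @^-1: A = C.
Proof.
move=> cAC; pose arr (B : {set T}) := enum B ++ enum (~: B).
have arr_uniq B : uniq (arr B).
  rewrite cat_uniq !enum_uniq andbT; apply/hasPn => i /=.
  by rewrite !mem_enum inE.
have arr_mem B i : i \in arr B by rewrite mem_cat !mem_enum inE orbN.
have arr_size B : size (arr B) = #|T| by rewrite size_cat -!cardE cardsC.
have idx B i : index i (arr B) < #|T| by rewrite -(arr_size B) index_mem.
have arr_nth x B k : k < #|T| -> (nth x (arr B) k \in B) = (k < #|B|).
  move=> kT; rewrite nth_cat -cardE; case: ltnP => kB.
    by rewrite -mem_enum mem_nth // -cardE.
  apply/negP => nB; suff: nth x (enum (~: B)) (k - #|B|) \in enum (~: B).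
    by rewrite mem_enum inE nB.
  by rewrite mem_nth // -cardE; have := cardsC B; lia.
pose f x := nth x (arr A) (index x (arr C)).
have f_inj : injective f.
  move=> x y; rewrite /f (set_nth_default y) ?arr_size // => /eqP.
  rewrite nth_uniq ?arr_size // => /eqP e.
  by rewrite -(nth_index x (arr_mem C x)) e nth_index.
exists (perm f_inj); apply/setP => x; rewrite inE permE arr_nth // cAC.
by rewrite -(arr_nth x) // nth_index.
Qed.

(* The nonempty fibres of [p |-> p @^-1: A] all have the same size. *)
Lemma card_perm_preim A C :
  #|[set p : {perm T} | p @^-1: A == C]| * 'C(#|T|, #|A|) <= #|{perm T}|.
Proof.
have [-> | [p0]] := set_0Vmem [set p : {perm T} | p @^-1: A == C].
  by rewrite cards0.
rewrite inE => /eqP p0A.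
have cAC : #|A| = #|C| by rewrite -p0A card_preimset //; apply: perm_inj.
rewrite -card_draws mulnC -sum_nat_const.
pose fib C' := [set p : {perm T} | p @^-1: A == C'].
apply: (@leq_trans (\sum_(C' in [set B : {set T} | #|B| == #|A|]) #|fib C'|)).
  apply: leq_sum => C'; rewrite inE => /eqP cC'.
  have [q qC] : exists q : {perm T}, q @^-1: C = C'.
    by apply: exists_perm_preim; rewrite cC'.
  rewrite -(card_imset _ (mulgI q)) subset_leq_card //.
  apply/subsetP => _ /imsetP[p + ->]; rewrite !inE => /eqP pC.
  by apply/eqP/setP => i; rewrite -qC -pC !inE permM.
rewrite -[X in _ <= X]sum1_card.
rewrite (partition_big (fun p : {perm T} => p @^-1: A)
  (mem [set B : {set T} | #|B| == #|A|])) /=; last first.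
  by move=> p _; rewrite inE card_preimset //; apply: perm_inj.
by apply: leq_sum => C' _; rewrite -sum1_card; under eq_bigl do rewrite inE.
Qed.

(** The displaced set [D] is the symmetric difference of [A] and its preimage, so it determines that
    preimage; sum the fibre bound over all small [D]. *)
Lemma card_small_displaced A s :
  #|[set p : {perm T} | #|displaced p A| <= s]| * 'C(#|T|, #|A|) <=
  #|[set D : {set T} | #|D| <= s]| * #|{perm T}|.
Proof.
pose sym D := [set i | (i \in A) (+) (i \in D)].
apply: (@leq_trans ((\sum_(D in [set D : {set T} | #|D| <= s])
    #|[set p : {perm T} | p @^-1: A == sym D]|) * 'C(#|T|, #|A|))).
  rewrite leq_mul2r; apply/orP; right.
  rewrite -sum1_card (partition_big (displaced^~ A)
    (mem [set D : {set T} | #|D| <= s])) /=; last by move=> p; rewrite !inE.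
  apply: leq_sum => D _; rewrite sum1_card subset_leq_card //.
  apply/subsetP => p; rewrite !inE => /andP[_ /eqP <-].
  by apply/eqP/setP => i; rewrite !inE; case: (i \in A); case: (p i \in A).
rewrite big_distrl /= -sum_nat_const; apply: leq_sum => D _.
exact: card_perm_preim.
Qed.

(** Give each set [D] the weight [q ^ (#|T| - #|D|)]. By the binomial theorem all weights add up to
    [q.+1 ^ #|T|], and a small set weighs at least [q ^ (#|T| - s)]. *)
Lemma card_small_sets q s :
  0 < q -> s <= #|T| ->
  #|[set D : {set T} | #|D| <= s]| * q ^ (#|T| - s) <= q.+1 ^ #|T|.
Proof.
move=> q0 sT; rewrite -sum_nat_const.
apply: (@leq_trans (\sum_(D : {set T}) q ^ (#|T| - #|D|))).
  rewrite big_mkcond; apply: leq_sum => D _; case: ifP => //.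
  by rewrite inE => Ds; apply: leq_pexp2l => //; lia.
rewrite (partition_big (fun D : {set T} => inord #|D| : 'I_#|T|.+1) predT) //=.
rewrite -[q.+1]addn1 expnDn; apply: leq_sum => k _.
rewrite exp1n muln1 -card_draws -sum_nat_const.
rewrite [X in X <= _](eq_bigl [in [set D : {set T} | #|D| == k]]) => [|D]; last first.
  by rewrite inE -val_eqE /= inordK // ltnS max_card.
by apply: leq_sum => D; rewrite inE => /eqP ->.
Qed.



(** With [q = 2j] and [#|T| = q * s], the weighted count leaves [(q (1 + 1/q)^q)^s], at most
    [(4q)^s]. *)
Lemma card_small_sets_half j s : 0 < j -> #|T| = j.*2 * s ->
  #|[set D : {set T} | #|D| <= s]| <= (8 * j) ^ s.
Proof.
move=> j0 cT; have sT : s <= #|T| by rewrite cT leq_pmull //; lia.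
have q0 : 0 < j.*2 by lia.
have := card_small_sets q0 sT; set B := #|_| => h.
have q0' : 0 < j.*2 ^ (#|T| - s) by rewrite expn_gt0 q0.
rewrite -(leq_pmul2r q0'); apply: (leq_trans h).
have -> : 8 * j = 4 * j.*2 by lia.
rewrite [(4 * _) ^ _]expnMn -mulnA -expnD subnKC //.
rewrite cT !expnM -expnMn.
by case: (s) => // k; rewrite leq_exp2r // expnS_leq.
Qed.

(* For balanced A, at most a 2 ^ (20 t) / 'C(n, #|A|) <= 2 ^ (- 150 t) fraction of
   the permutations displaces at most 2 t points; squaring this fraction pays
   for the union bound over the 'C(n, a) sets of each size a. *)
Lemma exists_expander t : 0 < t -> #|T| = 512 * t ->
  exists p1 p2 : {perm T}, forall A : {set T},
    #|T| <= 3 * #|A| -> 3 * #|A| <= 2 * #|T| ->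
    (2 * t < #|displaced p1 A|) || (2 * t < #|displaced p2 A|).
Proof.
move=> t0 cT; pose bal (A : {set T}) := (#|T| <= 3 * #|A| <= 2 * #|T|).
pose bad A := [set p : {perm T} | #|displaced p A| <= 2 * t].
have [/existsP[p1 /existsP[p2 /forallP h]]|/existsPn none] := boolP
  [exists p1, exists p2, forall A : {set T}, bal A ==>
    (2 * t < #|displaced p1 A|) || (2 * t < #|displaced p2 A|)].
  by exists p1, p2 => A A1 A2; apply: (implyP (h A)); rewrite /bal A1.
exfalso.
pose n := #|{perm T}|; pose B := #|[set D : {set T} | #|D| <= 2 * t]|.
have n0 : 0 < n by apply/card_gt0P; exists 1%g.
(* Here [j = 128] and [s = 2 * t], since [512 * t = 256 * (2 * t)]. *)
have leB : B <= 2 ^ (20 * t).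
  have -> : 2 ^ (20 * t) = (8 * 128) ^ (2 * t).
    have -> : 8 * 128 = 2 ^ 10 by [].
    by rewrite -expnM mulnA.
  by apply: card_small_sets_half => //; rewrite cT; lia.
have covered : n ^ 2 <= \sum_(A | bal A) #|bad A| ^ 2.
  rewrite -mulnn -card_prod.
  apply: (@leq_trans #|\bigcup_(A | bal A) setX (bad A) (bad A)|).
    rewrite subset_leq_card //; apply/subsetP => -[p1 p2] _.
    have /existsPn/(_ p2) := none p1; rewrite negb_forall => /existsP[A].
    rewrite negb_imply negb_or -!leqNgt => /and3P[balA A1 A2].
    by apply/bigcupP; exists A => //; rewrite !inE A1.
  apply: leq_trans (leq_card_bigcup _ _) _.
  by apply: leq_sum => A _; rewrite cardsX.
(* [170 * t] is just below [#|T| / 3]. A balanced set and its complement both have at least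
   [#|T| / 3] elements, and the smaller of them has at most half. *)
pose m := 170 * t; pose M := (B * n) ^ 2.
have binom A : bal A -> 2 ^ m <= 'C(#|T|, #|A|).
  move=> /andP[]; rewrite cT => A1 A2.
  have [le|gt] := leqP #|A|.*2 #|T|.
    rewrite -cT; apply: leq_trans (leq_exp2_bin le); rewrite leq_exp2l //; lia.
  have leA : #|A| <= #|T| by apply: max_card.
  rewrite -cT -(bin_sub leA).
  have le : (#|T| - #|A|).*2 <= #|T| by lia.
  by apply: leq_trans (leq_exp2_bin le); rewrite leq_exp2l //; lia.
(* The squared bound has two binomial factors: one is traded for [2 ^ m], the other later cancels
   the number of sets of the same size, so each of the [#|T|.+1] sizes contributes at most [M]. *)
have few : forall A, bal A -> 2 ^ m * #|bad A| ^ 2 * 'C(#|T|, #|A|) <= M.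
  move=> A /binom lebin; have := card_small_displaced A (2 * t).
  rewrite -/(bad A) -/B -/n /M => h; have := leq_mul h h; rewrite !mulnn.
  apply: leq_trans; rewrite expnMn -mulnA mulnC -mulnA leq_mul2l -mulnn.
  by rewrite leq_mul2l lebin !orbT.
have total : 2 ^ m * n ^ 2 <= #|T|.+1 * M.
  apply: leq_trans (_ : 2 ^ m * \sum_(A | bal A) #|bad A| ^ 2 <= _).
    by rewrite leq_mul2l covered orbT.
  rewrite big_distrr /=.
  rewrite (partition_big (fun A : {set T} => inord #|A| : 'I_#|T|.+1) predT) //=.
  rewrite -[X in _ <= X * _](card_ord #|T|.+1) -sum_nat_const.
  apply: leq_sum => k _.
  have Ck0 : 0 < 'C(#|T|, k) by rewrite bin_gt0 -ltnS.
  rewrite -(leq_pmul2l Ck0) mulnC big_distrl /=.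
  rewrite -card_draws -sum_nat_const [X in _ <= X]big_mkcond /= big_mkcond /=.
  apply: leq_sum => A _; case: ifP => // /andP[balA /eqP Ak].
  have kA : k = #|A| :> nat by rewrite -Ak inordK // ltnS max_card.
  by rewrite inE kA eqxx card_draws few.
have : 2 ^ m <= #|T|.+1 * B ^ 2.
  move: total; rewrite /M expnMn mulnA leq_pmul2r // expn_gt0 n0 //.
have leB2 : B ^ 2 <= 2 ^ (40 * t).
  by apply: leq_trans (leq_mul leB leB) _; rewrite -expnD leq_exp2l //; lia.
have leT : #|T|.+1 <= 2 ^ (10 * t).
  have lt_t : t < 2 ^ t by apply: ltn_expl.
  have le9 : 2 ^ 9 <= 2 ^ (9 * t) by rewrite leq_exp2l //; lia.
  rewrite cT (_ : 10 * t = 9 * t + t); last by lia.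
  rewrite expnD; apply: leq_trans (leq_mul le9 lt_t).
  by rewrite (_ : 2 ^ 9 = 512) //; lia.
(* The contradiction is [10 t + 40 t < 170 t] in the exponents. *)
apply/negP; rewrite -ltnNge; apply: leq_ltn_trans (leq_mul leT leB2) _.
by rewrite -expnD ltn_exp2l // /m; lia.
Qed.

End Expander.

(** * Random independent sets *)

Section Isolated.
Variables (V : finType) (N : V -> {set V}).
Hypothesis N_refl : forall v, v \in N v.
Hypothesis N_sym : forall v w, (w \in N v) = (v \in N w).
Hypothesis card_N : forall v, #|N v| <= 4.

Definition isolated (b : {set V}) : {set V} := [set v | b :&: N v == [set v]].

Lemma isolated_nbhd b v w :
  w \in N v -> v != w -> ~~ ((v \in isolated b) && (w \in isolated b)).
Proof.
move=> wNv vw; rewrite !inE; apply/negP => /andP[/eqP bv /eqP bw].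
have : w \in b :&: N v.
  by rewrite inE wNv andbT; have := set11 w; rewrite -bw inE => /andP[].
by rewrite bv inE eq_sym (negPf vw).
Qed.

Definition avoiding (S : {set V}) : {set {set V}} :=
  [set b | [disjoint isolated b & S]].

Lemma avoidingP (S : {set V}) b :
  reflect {in S, forall v, b :&: N v != [set v]} (b \in avoiding S).
Proof.
rewrite inE disjoint_sym disjoint_subset.
apply: (iffP subsetP) => h v vS; have := h v vS; first by rewrite !inE.
by rewrite !inE.
Qed.

Definition scattered (S : {set V}) : Prop :=
  {in S &, forall v w, v != w -> [disjoint N v & N w]}.

(* Resampling N v turns every b into one for which v is isolated, at most
   2 ^ 4-to-one, and does not affect the other vertices of S. *)
Lemma card_avoiding_scattered S :
  scattered S -> 16 ^ #|S| * #|avoiding S| <= 15 ^ #|S| * 2 ^ #|V|.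
Proof.
move: {2}#|S| (erefl #|S|) => n; elim: n S => [|n IH] S cS scS; rewrite cS.
  rewrite !mul1n -cardsT -card_powerset; apply: subset_leq_card.
  by apply/subsetP => b _; rewrite inE subsetT.
have /card_gt0P[v vS] : 0 < #|S| by rewrite cS.
pose S1 := S :\ v.
have cS1 : #|S1| = n by have := cardsD1 v S; rewrite vS cS => -[].
have scS1 : scattered S1.
  by move=> x y /setD1P[_ xS] /setD1P[_ yS]; apply: scS.
have disj w : w \in S1 -> [disjoint N v & N w].
  by case/setD1P=> wv wS; apply: scS; rewrite // eq_sym.
have := IH S1 cS1 scS1; rewrite cS1.
pose good := [set b in avoiding S1 | b :&: N v == [set v]].
have split_avoid : #|avoiding S| + #|good| <= #|avoiding S1|.
  have -> : #|avoiding S| + #|good| = #|avoiding S :|: good|.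
    rewrite cardsU (_ : _ :&: _ = set0) ?cards0 ?subn0 //.
    apply/setP => b; rewrite [RHS]inE; apply/negP => /setIP[/avoidingP/(_ v vS)].
    by move=> /negPf bv; rewrite inE bv andbF.
  apply/subset_leq_card/subsetP => b /setUP[/avoidingP h|].
    by apply/avoidingP => w /setD1P[_ wS]; apply: h.
  by rewrite inE => /andP[].
have resample : #|avoiding S1| <= #|good| * 16.
  (* The second component stores the part of [b] that resampling erases, which makes the map
     injective. *)
  pose f b := (v |: (b :\: N v), b :&: N v).
  have f_inj : injective f.
    move=> b c [/setP e1 /setP e2]; apply/setP => x.
    have := e1 x; have := e2 x; rewrite !inE; case: (x =P v) => [->|_] /=.
      by rewrite N_refl !andbT.
    by case: (x \in N v); rewrite ?andbT.
  rewrite -(card_imset _ f_inj).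
  apply: (@leq_trans #|setX good (powerset (N v))|); last first.
    rewrite cardsX card_powerset leq_mul2l; apply/orP; right.
    by rewrite -[16]/(2 ^ 4) leq_exp2l.
  apply/subset_leq_card/subsetP => _ /imsetP[b /avoidingP h ->].
  apply/setXP; split; last by rewrite powersetE subsetIr.
  rewrite [_ \in good]inE /=; apply/andP; split; last first.
    apply/eqP/setP => x; rewrite !inE; case: (x =P v) => [->|_] /=.
      by rewrite N_refl.
    by case: (x \in N v); rewrite ?andbF.
  apply/avoidingP => w wS1.
  have -> // : (v |: b :\: N v) :&: N w = b :&: N w; last exact: h.
  apply/setP => x; rewrite !inE; case xNw: (x \in N w); rewrite ?andbF //=.
  have xNv : x \in N v = false by apply: (disjointFl (disj w wS1)).
  rewrite xNv !andbT; case: (x =P v) => // e.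
  by move: xNv; rewrite e N_refl.
(* At least 1/16 of [avoiding S1] is good and thus lost to [avoiding S], so each vertex of [S] costs
   a factor 15/16. *)
rewrite !expnS => IHn; nia.
Qed.

(** Greedy choice: keep a vertex [v] and discard everything within distance 2 of it, at most [4 * 4]
    vertices. The remaining vertices have closed neighbourhoods disjoint from [N v]. *)
Lemma exists_scattered (S : {set V}) :
  exists S' : {set V}, [/\ S' \subset S, scattered S' & #|S| <= 16 * #|S'|].
Proof.
move: {2}#|S| (leqnn #|S|) => n; elim: n S => [|n IH] S cS.
  by exists S; split=> //; [move=> v w; have := cS; rewrite leqn0 cards_eq0 =>
    /eqP ->; rewrite inE | lia].
have [->|[v vS]] := set_0Vmem S.
  by exists set0; split=> [||]; rewrite ?sub0set ?cards0 // => v w; rewrite inE.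
pose ball := \bigcup_(u in N v) N u.
have card_ball : #|ball| <= 16.
  apply: leq_trans (leq_card_bigcup _ _) _.
  apply: (@leq_trans (\sum_(u in N v) 4)); first exact: leq_sum.
  by rewrite sum_nat_const; have := card_N v; lia.
have v_ball : v \in ball by apply/bigcupP; exists v.
have card_S : #|S| = #|S :&: ball| + #|S :\: ball| by rewrite cardsID.
have I_le : #|S :&: ball| <= 16.
  by apply: leq_trans card_ball; rewrite subset_leq_card ?subsetIr.
have I_gt0 : 0 < #|S :&: ball| by apply/card_gt0P; exists v; rewrite inE vS.
have [|S1 [sS1 scS1 cS1]] := IH (S :\: ball); first by lia.
have far w : w \in S1 -> [disjoint N v & N w].
  move=> /(subsetP sS1)/setDP[_ w_ball]; rewrite -setI_eq0.
  apply: contraR w_ball => /set0Pn[u /setIP[uv uw]].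
  by apply/bigcupP; exists u; rewrite // N_sym.
have vS1 : v \notin S1.
  by apply/negP => /(subsetP sS1); rewrite inE v_ball.
exists (v |: S1); split.
- rewrite subUset sub1set vS; apply: subset_trans sS1 _; exact: subsetDl.
- move=> x y /setU1P[->|xS] /setU1P[->|yS] xy; first by rewrite eqxx in xy.
  + exact: far.
  + by rewrite disjoint_sym; apply: far.
  + exact: scS1.
- by rewrite cardsU1 vS1; lia.
Qed.

(** Avoiding [S] implies avoiding a scattered subset; its vertices beyond the first [r] only improve
    the bound and are cancelled. *)
Lemma card_avoiding r (S : {set V}) :
  16 * r <= #|S| -> 16 ^ r * #|avoiding S| <= 15 ^ r * 2 ^ #|V|.
Proof.
move=> rS; have [S' [sS' scS' cS']] := exists_scattered S.
have rS' : r <= #|S'| by lia.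
have avS : #|avoiding S| <= #|avoiding S'|.
  apply/subset_leq_card/subsetP => b /avoidingP h.
  by apply/avoidingP => v /(subsetP sS'); apply: h.
have := card_avoiding_scattered scS'; rewrite -(subnKC rS') !expnD => h.
have le : 15 ^ (#|S'| - r) <= 16 ^ (#|S'| - r).
  by case: (_ - _) => // k; rewrite leq_exp2r.
have pos : 0 < 16 ^ (#|S'| - r) by rewrite expn_gt0.
rewrite -(leq_pmul2l pos).
apply: leq_trans (_ : 16 ^ r * 16 ^ (#|S'| - r) * #|avoiding S'| <= _).
  by rewrite mulnA [_ * 16 ^ r]mulnC leq_mul2l avS orbT.
apply: leq_trans h _; rewrite mulnA [_ * 15 ^ r]mulnC.
by rewrite leq_mul2r leq_mul2l le !orbT.
Qed.

End Isolated.

(** * Balanced rectangles of a DNNF *)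

Section Locality.
Variables (X : eqType) (D : nnf X).
Implicit Types (u v w : gate D) (f : X -> bool).

Lemma vars_sub_connect u v :
  connect (@wire _ D) u v -> {subset vars (sub u) <= vars (sub v)}.
Proof.
move=> uv x /mem_vars_sub[w wu xw]; apply/mem_vars_sub.
by exists w; rewrite // (connect_trans wu).
Qed.

Lemma eq_gate_value f f' v :
  {in vars (sub v), f =1 f'} -> gate_value f v = gate_value f' v.
Proof.
rewrite /gate_value; move: #|_| => n; elim: n v => [|n IHn] v ff' /=.
  case E: (gate_label v) => [|x b||] //; rewrite ff' //.
  by apply/mem_vars_sub; exists v; rewrite ?E.
have IH u : wire u v -> gate_value_rec f n u = gate_value_rec f' n u.
  move=> uv; apply: IHn => x xu; apply: ff'.
  exact: vars_sub_connect (connect1 uv) _ xu.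
case E: (gate_label v) => [|x b||] //.
- by rewrite ff' //; apply/mem_vars_sub; exists v; rewrite ?E.
- by apply: eq_forallb => u; case uv: (wire u v) => //=; apply: IH.
- by apply: eq_existsb => u; case uv: (wire u v) => //=; apply: IH.
Qed.

Lemma wire_into_nonsource u v :
  wire u v -> is_input (gate_label v) = false.
Proof. by move=> uv; rewrite input_source; apply/forallP => /(_ u); rewrite uv. Qed.

(** The number of ancestors is the rank by which a lowest gate is chosen below. *)
Lemma ancestors_wire u v : wire u v ->
  #|[pred t | connect (@wire _ D) t u]| < #|[pred t | connect (@wire _ D) t v]|.
Proof.
move=> uv; apply: proper_card; apply/properP; split.
  by apply/subsetP => t; rewrite !inE => tu; apply: connect_trans (connect1 uv).
by exists v; rewrite !inE ?connect0 ?wire_acyclic.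
Qed.

End Locality.

Section RectangleCover.
Variables (X : eqType) (D : nnf X) (T : finType) (g : T -> X).
Hypothesis dnnfD : is_dnnf D.
Hypothesis g_inj : injective g.
Implicit Types (u v w c : gate D) (f : X -> bool) (s : seq X).

(** Only variables in the image of [g] are weighed; for the formula, these are the left vertices. *)
Definition weight s : nat := #|[set i | g i \in s]|.

Definition balanced s : bool := #|T| <= 3 * weight s <= 2 * #|T|.

Lemma weight_cat s1 s2 : weight (s1 ++ s2) <= weight s1 + weight s2.
Proof.
apply: leq_trans (leq_card_setU _ _); apply/subset_leq_card/subsetP => i.
by rewrite !inE mem_cat.
Qed.

Lemma weight_le1 s : {in s &, forall x y, x = y} -> weight s <= 1.
Proof.
move=> s1; apply/card_le1_eqP => i j; rewrite !inE => si sj.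
exact/g_inj/s1.
Qed.

(** Each further list adds at most a third of the total weight, so the growing prefix cannot jump
    over the interval from one third to two thirds. *)
Lemma exists_balanced_prefix s (ss : seq (seq X)) :
  3 * weight s <= 2 * #|T| -> {in ss, forall b, 3 * weight b <= #|T|} ->
  #|T| <= 3 * weight (s ++ flatten ss) ->
  exists k, balanced (s ++ flatten (take k ss)).
Proof.
elim: ss s => [|b ss IH] s s_light ss_light; have [s_heavy _|s_light'] :=
  leqP #|T| (3 * weight s).
- by exists 0; rewrite /balanced cats0 s_heavy.
- by rewrite cats0 => ?; lia.
- by exists 0; rewrite /balanced cats0 s_heavy.
- rewrite /= catA => heavy_cat.
  have b_light : 3 * weight b <= #|T| by apply: ss_light; rewrite mem_head.
  have [||//|k balk] := IH (s ++ b).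
  + by have := weight_cat s b; lia.
  + by move=> c cs; apply: ss_light; rewrite inE cs orbT.
  + by exists k.+1; rewrite /= catA.
Qed.

Definition heavy v : bool := 2 * #|T| < 3 * weight (vars (sub v)).

(* Taking [u] true makes [w] true: if [w] is a conjunction, its other inputs
   are already true. *)
Definition good_wire f : rel (gate D) := fun u w =>
  wire u w && (is_and (gate_label w) ==>
    [forall (c | wire c w), (c != u) ==> gate_value f c]).

Definition through f u v : bool :=
  [&& wire u v, gate_value f u, gate_value f v
    & connect (good_wire f) v (output D)].

(** At a conjunction every input must be light, because the partition is built from the variable
    sets of several inputs; at a disjunction it is built around [u] alone. *)
Definition threshold u v : bool :=
  heavy v && (if is_and (gate_label v) then [forall (c | wire c v), ~~ heavy c]
              else ~~ heavy u).

Definition rectangle f (p : gate D * gate D) : bool :=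
  threshold p.1 p.2 && through f p.1 p.2.

Lemma heavy_nonsource v : 1 < #|T| -> heavy v -> ~~ is_input (gate_label v).
Proof.
move=> T1; rewrite /heavy ltnNge; apply: contra; rewrite input_source => srcv.
have src u : connect (@wire _ D) u v -> u = v.
  move=> /connectP[p]; elim/last_ind: p => [_ -> //|p w _].
  rewrite rcons_path last_rcons => /andP[_ + e].
  by have := forallP srcv (last u p); rewrite e => /negPf ->.
suff : weight (vars (sub v)) <= 1 by lia.
apply: weight_le1 => x y /mem_vars_sub[u /src-> xv] /mem_vars_sub[w /src-> yv].
by move: xv; rewrite yv => -[].
Qed.

(** Among the true heavy gates with a good path to the output, take one with fewest ancestors. Any
    true input joined to it by a good wire is then light. At a true conjunction this covers all
    inputs, at a true disjunction at least one. *)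
Lemma rectangle_cover f : 1 < #|T| -> heavy (output D) -> value D f ->
  exists2 p, wire p.1 p.2 & rectangle f p.
Proof.
move=> T1 heavy_out Df.
pose P v := [&& heavy v, gate_value f v & connect (good_wire f) v (output D)].
have P_out : P (output D) by rewrite /P heavy_out connect0 andbT.
case: (@arg_minnP _ _ P
  (fun v => #|[pred t | connect (@wire _ D) t v]|) P_out) => v Pv v_min.
have {v_min} light c : wire c v -> gate_value f c -> good_wire f c v -> ~~ heavy c.
  move=> cv fc good_cv; apply/negP => heavy_c; have := ancestors_wire cv.
  rewrite ltnNge v_min // /P heavy_c fc.
  by case/and3P: Pv => _ _; apply: connect_trans (connect1 good_cv).
case/and3P: Pv => heavy_v fv v_out; have := heavy_nonsource T1 heavy_v.
case E: (gate_label v) => // _.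
- have all_true c : wire c v -> gate_value f c.
    by move: fv; rewrite gate_valueE E => /forallP/(_ c)/implyP.
  have light_and c : wire c v -> ~~ heavy c.
    move=> cv; apply: light => //; first exact: all_true.
    rewrite /good_wire cv E; apply/forallP => d; apply/implyP => dv.
    by rewrite all_true ?implybT.
  have : ~~ [forall u, ~~ wire u v] by rewrite -input_source E.
  rewrite negb_forall => /existsP[u]; rewrite negbK => uv.
  exists (u, v) => //; rewrite /rectangle /threshold /through /= heavy_v E.
  rewrite uv fv v_out all_true //= !andbT.
  by apply/forallP => c; apply/implyP; apply: light_and.
- have := fv; rewrite gate_valueE E => /existsP[u /andP[uv fu]].
  exists (u, v) => //; rewrite /rectangle /threshold /through /= heavy_v E.
  by rewrite uv fv v_out fu light // /good_wire uv E.
Qed.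

(** Truth climbs the good path of [f']. At a conjunction, decomposability keeps the variables of the
    other inputs apart from those of the gate below, so [f] agrees with [f'] on them and these
    inputs stay true. *)
Lemma good_path_value f f' v : connect (good_wire f') v (output D) ->
  (forall x, x \notin vars (sub v) -> f x = f' x) -> gate_value f v ->
  value D f.
Proof.
move=> /connectP[p]; elim: p v => [|w p IH] v /=.
  by rewrite /value => _ ->.
move=> /andP[/andP[vw /implyP good_vw] wp] out ff' fv.
apply: (IH w) => //.
  move=> x xw; apply: ff'; apply: contra xw.
  exact: vars_sub_connect (connect1 vw) x.
rewrite gate_valueE; have := wire_into_nonsource vw.
case E: (gate_label w) => //= _; last first.
  by apply/existsP; exists v; rewrite vw.
apply/forallP => c; apply/implyP => cw.
have [-> //|cv] := eqVneq c v.
rewrite (@eq_gate_value _ _ f f').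
  have := good_vw; rewrite E => /(_ isT)/forallP/(_ c)/implyP/(_ cw).
  by rewrite cv.
move=> x xc; apply: ff'.
have and_w : is_and (gate_label w) by rewrite E.
by have /hasPn/(_ x xc) := dnnfD and_w vw cw ltac:(by rewrite eq_sym).
Qed.

Definition mix s f f' : X -> bool := fun x => if x \in s then f x else f' x.

(** The set [s] lies within the variables of [v], so outside them the mixture is [f'], whose good
    path leads from [v] to the output. It remains to make [v] true: each relevant input of [v] sees
    only [f] or only [f']. *)
Lemma rectangle_mix p : wire p.1 p.2 -> threshold p.1 p.2 ->
  2 < #|T| -> exists2 s, balanced s & forall f f', rectangle f p -> rectangle f' p ->
    value D (mix s f f').
Proof.
case: p => u v /= uv /andP[heavy_v]; have := wire_into_nonsource uv.
case E: (gate_label v) => //= _ + T1.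
- move=> /forallP light.
  have [B [B_sub balB]] :
      exists B : seq (gate D), {in B, forall c, wire c v} /\
        balanced (flatten [seq vars (sub c) | c <- B]).
    (* An input weighing more than a third is balanced by itself, being light; otherwise inputs are
       added one at a time. *)
    have [/existsP[c /andP[cv heavy_c]]|] :=
        boolP [exists c, wire c v && (#|T| < 3 * weight (vars (sub c)))].
      exists [:: c]; split; first by move=> d; rewrite inE => /eqP ->.
      rewrite /balanced /= cats0 (ltnW heavy_c) leqNgt.
      exact: (implyP (light c)).
    rewrite negb_exists => /forallP light'.
    pose B := enum [pred c | wire c v].
    have [|b /mapP[c]||k] :=
        @exists_balanced_prefix [::] [seq vars (sub c) | c <- B].
    + by rewrite /weight (_ : [set _ | _] = set0) ?cards0 //; apply/setP => i;
        rewrite !inE.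
    + rewrite mem_enum inE => cv ->.
      by have := light' c; rewrite cv /= -leqNgt.
    + apply: (@leq_trans (3 * weight (vars (sub v)))).
        by move: heavy_v; rewrite /heavy; lia.
      rewrite leq_mul2l /=; apply/subset_leq_card/subsetP => i; rewrite !inE.
      move=> /mem_vars_sub[w /connectP[q]].
      elim/last_ind: q => [_ /= <-|q z _]; first by rewrite E.
      rewrite rcons_path last_rcons => /andP[wq + ez]; rewrite -ez => qv wi.
      apply/flattenP; exists (vars (sub (last w q))).
        by apply: map_f; rewrite mem_enum inE.
      by apply/mem_vars_sub; exists w => //; apply/connectP; exists q.
    + rewrite -map_take => bal; exists (take k B); split=> // c /mem_take.
      by rewrite mem_enum inE.
  exists (flatten [seq vars (sub c) | c <- B]) => // f f'.
  move=> /andP[_ /and4P[_ _ fv _]] /andP[_ /and4P[_ _ f'v f'_out]].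
  have BP x : reflect (exists2 c, c \in B & x \in vars (sub c))
                 (x \in flatten [seq vars (sub c) | c <- B]).
    exact: flatten_mapP.
  apply: (good_path_value f'_out).
    move=> x xv; rewrite /mix; case: BP => // -[c cB xc].
    by case/negP: xv; apply: vars_sub_connect (connect1 (B_sub c cB)) x xc.
  move: fv f'v; rewrite !gate_valueE E => /forallP fv /forallP f'v.
  apply/forallP => c; apply/implyP => cv.
  have [cB|cB] := boolP (c \in B).
    rewrite (@eq_gate_value _ _ _ f); first exact: (implyP (fv c)).
    by move=> x xc; rewrite /mix; case: BP => // -[]; exists c.
  rewrite (@eq_gate_value _ _ _ f'); first exact: (implyP (f'v c)).
  move=> x xc; rewrite /mix; case: BP => // -[d dB xd].
  have and_v : is_and (gate_label v) by rewrite E.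
  have dc : d != c by apply: contraNneq cB => <-.
  have /hasPn/(_ x xc) := dnnfD and_v (B_sub d dB) cv dc.
  by rewrite /= xd.
- rewrite /heavy -leqNgt => light_u.
  (* Starting from the variables of [u], those of [v] are added singly; each weighs at most 1, which
     is at most a third because [2 < #|T|]. *)
  have [b /mapP[x _ ->]||k] := @exists_balanced_prefix (vars (sub u))
      [seq [:: x] | x <- vars (sub v)] light_u.
  + apply: leq_trans T1; rewrite (leq_mul2l 3 _ 1) /=.
    by apply: weight_le1 => y z; rewrite !inE => /eqP -> /eqP ->.
  + apply: (@leq_trans (3 * weight (vars (sub v)))).
      by move: heavy_v; rewrite /heavy; lia.
    rewrite leq_mul2l /=; apply/subset_leq_card/subsetP => i; rewrite !inE.
    by rewrite mem_cat flatten_seq1 => ->; rewrite orbT.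
  rewrite -map_take flatten_seq1; set s := _ ++ _ => bal.
  have s_sub : {subset s <= vars (sub v)}.
    move=> x; rewrite mem_cat => /orP[|/mem_take //].
    exact: vars_sub_connect (connect1 uv) x.
  exists s => // f f'.
  move=> /andP[_ /and4P[_ fu _ _]] /andP[_ /and4P[_ _ _ f'_out]].
  apply: (good_path_value f'_out).
    by move=> x xv; rewrite /mix; case: ifP => // /s_sub; rewrite (negPf xv).
  rewrite gate_valueE E; apply/existsP; exists u; rewrite uv /=.
  rewrite (@eq_gate_value _ _ _ f) // => x xu.
  by rewrite /mix mem_cat xu.
Qed.

End RectangleCover.

(** * The vertex cover formula *)

Section BipartiteFormula.
Local Open Scope fset_scope.
Local Open Scope nat_scope.
Variables (X : countType) (T : finType) (i0 : T).
Variables (p : 'I_3 -> {perm T}) (x_ : T * bool -> X).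
Hypothesis x_inj : injective x_.
Implicit Types (i j : T) (k : 'I_3) (v w : T * bool) (f : X -> bool).
Implicit Types b : {set T * bool}.

(** The Boolean of a vertex is its side, [false] for left. The pair [(i, k)] names the edge at [i]
    in the [k]-th matching. *)
Definition edge_clause (e : T * 'I_3) : {fset X * bool} :=
  [fset (x_ (e.1, false), true); (x_ (p e.2 e.1, true), true)].

Definition edge_clauses : {fset {fset X * bool}} :=
  [fset edge_clause e | e in {: T * 'I_3}].

Lemma edge_clausesP (K : {fset X * bool}) :
  reflect (exists e, K = edge_clause e) (K \in edge_clauses).
Proof.
by apply: (iffP (imfsetP _ _ _ _)) => [[e _ ->]|[e ->]]; exists e.
Qed.

Lemma edge_clauses_neq0 : edge_clauses != fset0.
Proof.
by apply/fset0Pn; exists (edge_clause (i0, ord0)); apply/edge_clausesP;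
  exists (i0, ord0).
Qed.

Lemma edge_clause_neq0 : fset0 \notin edge_clauses.
Proof.
apply/edge_clausesP => -[e /fsetP/(_ (x_ (e.1, false), true))].
by rewrite !inE eqxx.
Qed.

Definition edge_cnf : cnf X := CNF edge_clauses_neq0 edge_clause_neq0.

Lemma edge_cnf_monotone : monotone edge_cnf.
Proof. by move=> K /edge_clausesP[e ->] l; rewrite !inE => /orP[] /eqP ->. Qed.

Lemma edge_cnf_is_2cnf : is_kcnf 2 edge_cnf.
Proof. by move=> K /edge_clausesP[e ->]; rewrite cardfs2; case: eqP. Qed.

(** Only an inequality, since an edge lying in several matchings yields a single clause. *)
Lemma sum_edge_clauses_le (F : {fset X * bool} -> nat) :
  \sum_(K <- edge_clauses) F K <= \sum_(e : T * 'I_3) F (edge_clause e).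
Proof.
rewrite -(big_map edge_clause xpredT F).
apply: (@sub_le_big_seq _ addn leq leqnn (fun m n => leq_addr n m)) => K.
rewrite count_uniq_mem ?fset_uniq //.
case: (boolP (K \in edge_clauses)) => // /edge_clausesP[e ->].
by rewrite -has_count has_pred1; apply: map_f; rewrite mem_index_enum.
Qed.

Lemma edge_cnf_size_le : nnf_size edge_cnf <= 9 * #|T|.
Proof.
rewrite cnf_sizeE.
apply: leq_trans (sum_edge_clauses_le (fun K => #|` K| + 1)) _.
apply: (@leq_trans (\sum_(e : T * 'I_3) 3)).
  by apply: leq_sum => e _; rewrite cardfs2; case: (_ != _).
by rewrite sum_nat_const card_prod card_ord; lia.
Qed.

Lemma edge_clause_diag_inj : injective (fun i => edge_clause (i, ord0)).
Proof.
move=> i j /fsetP/(_ (x_ (i, false), true)); rewrite !inE eqxx /= => /esym.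
by case/orP=> /eqP[/x_inj[]].
Qed.

(** The clauses of one matching are already pairwise distinct. *)
Lemma edge_cnf_size_ge : #|T| <= nnf_size edge_cnf.
Proof.
rewrite cnf_sizeE; apply: (@leq_trans #|` edge_clauses|); last first.
  by rewrite -sum1_size; apply: leq_sum => K _; rewrite addn1.
pose diag := [fset edge_clause (i, ord0) | i in T].
have -> : #|T| = #|` diag| by rewrite card_imfset ?cardE //; apply: edge_clause_diag_inj.
apply: fsubset_leq_card; apply/fsubsetP => _ /imfsetP[i _ ->].
by apply/edge_clausesP; exists (i, ord0).
Qed.

Lemma occurrences_edge_clause (e : T * 'I_3) (x : X) :
  #|` [fset l in edge_clause e | l.1 == x]| <=
  (x_ (e.1, false) == x) + (x_ (p e.2 e.1, true) == x).
Proof.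
apply: (@leq_trans
  #|` (if x_ (e.1, false) == x then [fset (x, true)] else fset0) `|`
      (if x_ (p e.2 e.1, true) == x then [fset (x, true)] else fset0)|).
  apply: fsubset_leq_card; apply/fsubsetP => l; rewrite !inE /=.
  move=> /andP[/orP[] /eqP -> /= /eqP ->]; rewrite eqxx !inE eqxx ?orbT //.
apply: leq_trans (leq_card_fsetU _ _) _.
by case: eqP => _; case: eqP => _; rewrite ?cardfs1 ?cardfs0.
Qed.

(** Each matching has at most one edge at a given vertex; [i1] below is the left endpoint of that
    edge. *)
Lemma edge_cnf_read3 : read_times 3 edge_cnf.
Proof.
move=> x; rewrite /occurrences.
apply: leq_trans (sum_edge_clauses_le
  (fun K => #|` [fset l in K | l.1 == x]|)) _.
apply: (@leq_trans (\sum_(k : 'I_3) 1)); last by rewrite sum1_card card_ord.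
rewrite (eq_bigr (fun e => #|` [fset l in edge_clause (e.1, e.2) | l.1 == x]|));
  last by case.
rewrite -(pair_bigA _ (fun i k => #|` [fset l in edge_clause (i, k) | l.1 == x]|)).
rewrite exchange_big /=; apply: leq_sum => k _.
apply: (@leq_trans (\sum_i ((x_ (i, false) == x) + (x_ (p k i, true) == x)))).
  by apply: leq_sum => i _; apply: (occurrences_edge_clause (i, k)).
have [/existsP[[j c] /eqP <-]|none] := boolP [exists v, x_ v == x]; last first.
  rewrite big1 // => i _; rewrite negb_exists in none; have h := forallP none.
  by rewrite (negPf (h _)) (negPf (h _)).
pose i1 := if c then (p k)^-1%g j else j.
rewrite (bigD1 i1) //= big1 => [|i ii1].
  rewrite addn0 !(inj_eq x_inj) !xpair_eqE.
  by case: (c); rewrite ?andbF ?addn0 //; case: (_ == _).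
rewrite !(inj_eq x_inj) !xpair_eqE.
move: ii1; rewrite /i1; case: (c) => ii1; rewrite ?andbF ?andbT /= ?addn0.
  by rewrite -[j](permKV (p k)) (inj_eq perm_inj) (negPf ii1).
by rewrite (negPf ii1).
Qed.

Lemma edge_cnf_value f :
  value edge_cnf f = [forall e, f (x_ (e.1, false)) || f (x_ (p e.2 e.1, true))].
Proof.
rewrite cnf_valueE; apply/forallP/forallP => h.
  move=> e; have eF : edge_clause e \in edge_clauses by apply/edge_clausesP; exists e.
  have /existsP[[l lK] /=] := h [` eF].
  by move: lK; rewrite /= !inE => /orP[] /eqP -> /= /eqP ->; rewrite ?orbT.
move=> [K KF]; have /edge_clausesP[e eK] := KF; apply/existsP.
have [f1|f2] := orP (h e).
  have lK : (x_ (e.1, false), true) \in K by rewrite eK !inE eqxx.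
  by exists [` lK]; rewrite /= f1.
have lK : (x_ (p e.2 e.1, true), true) \in K by rewrite eK !inE eqxx orbT.
by exists [` lK]; rewrite /= f2.
Qed.

Definition nbhd v : {set T * bool} :=
  v |: (if v.2 then [set ((p k)^-1%g v.1, false) | k : 'I_3]
        else [set (p k v.1, true) | k : 'I_3]).

Lemma nbhd_refl v : v \in nbhd v.
Proof. exact: setU11. Qed.

Lemma nbhd_edge i k : (p k i, true) \in nbhd (i, false).
Proof. by rewrite inE; apply/orP; right; apply/imsetP; exists k. Qed.

Lemma nbhd_sym v w : (w \in nbhd v) = (v \in nbhd w).
Proof.
have sub v' w' : w' \in nbhd v' -> v' \in nbhd w'.
  case: v' w' => [i []] [j c]; rewrite !inE /= => /predU1P[[-> ->]|].
  - by rewrite eqxx.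
  - case/imsetP=> k _ [-> ->] /=; apply/orP; right; apply/imsetP; exists k => //.
    by rewrite permKV.
  - by rewrite eqxx.
  - case/imsetP=> k _ [-> ->] /=; apply/orP; right; apply/imsetP; exists k => //.
    by rewrite permK.
by apply/idP/idP; apply: sub.
Qed.

Lemma card_nbhd v : #|nbhd v| <= 4.
Proof.
rewrite cardsU1 (_ : 4 = 1 + #|'I_3|); last by rewrite card_ord.
apply: leq_add; first exact: leq_b1.
by case: v.2; apply: leq_imset_card.
Qed.

(* The vertices isolated in b form an independent set, so their complement is a
   vertex cover; a uniform b gives the distribution used to count rectangles. *)
Definition cover_assign b : X -> bool :=
  fun x => [forall v, (x_ v == x) ==> (v \notin isolated nbhd b)].

Lemma cover_assignE b v : cover_assign b (x_ v) = (v \notin isolated nbhd b).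
Proof.
apply/forallP/idP => [/(_ v)|h w]; first by rewrite eqxx.
by apply/implyP => /eqP/x_inj ->.
Qed.

Lemma value_cover_assign b : value edge_cnf (cover_assign b).
Proof.
rewrite edge_cnf_value; apply/forallP => -[i k] /=.
rewrite !cover_assignE -negb_and; apply: isolated_nbhd (nbhd_edge i k) _.
by rewrite xpair_eqE andbF.
Qed.

(** * Counting the rectangles of a DNNF for the formula *)

Section LowerBound.
Variables (t : nat) (D : nnf X).
Hypothesis p_id : p ord0 = 1%g.
Hypothesis p_expanding : forall A : {set T},
  #|T| <= 3 * #|A| -> 3 * #|A| <= 2 * #|T| ->
  exists k, 2 * t < #|displaced (p k) A|.
Hypotheses (T2 : 2 < #|T|) (dnnfD : is_dnnf D) (eqD : equivalent D edge_cnf).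

Let g i := x_ (i, false).

Let g_inj : injective g.
Proof. by move=> i j /x_inj[]. Qed.

(** [D] depends on every left variable: when the right endpoint of an edge is the only false
    variable, also falsifying the left endpoint violates its clause. *)
Lemma heavy_edge_output : heavy g (output D).
Proof.
rewrite /heavy /weight (_ : [set _ | _] = setT) ?cardsT; first by lia.
apply/setP => i; rewrite !inE; apply/negPn/negP => i_out.
pose f x := x != x_ (p ord0 i, true).
pose f' x := (x != g i) && f x.
have : value D f = value D f'.
  apply: eq_gate_value => x x_out; rewrite /f' (_ : x != g i) //.
  by apply: contraNneq i_out => <-.
rewrite !eqD !edge_cnf_value (_ : [forall e, _] = true).
  by move/esym/forallP/(_ (i, ord0)); rewrite /f' /f /= !eqxx /= andbF.
by apply/forallP => e; apply/orP; left; apply/eqP => /x_inj.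
Qed.

(* If the matchings 1 and [p k] are both nearly uncrossed, then B is close to A
   and to the image of A under [p k], so [p k] nearly preserves A. *)
Lemma exists_crossing_matching (A B : {set T}) :
  #|T| <= 3 * #|A| -> 3 * #|A| <= 2 * #|T| ->
  exists k, t < #|[set i | (i \in A) != (p k i \in B)]|.
Proof.
move=> A1 A2; have [k kA] := p_expanding A1 A2.
pose M k := [set i | (i \in A) != (p k i \in B)].
have [M0|M0] := leqP #|M ord0| t; last by exists ord0.
exists k; rewrite -/(M k).
suff : #|displaced (p k) A| <= #|M k| + #|M ord0| by lia.
have <- : #|p k @^-1: M ord0| = #|M ord0|.
  by apply: card_preimset; apply: perm_inj.
apply: leq_trans (leq_card_setU _ _); apply/subset_leq_card/subsetP => i.
rewrite !inE p_id perm1.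
by case: (i \in A); case: (p k i \in A); case: (p k i \in B).
Qed.

(** More than [t] edges of one matching cross the partition, and the covers in the rectangle all
    avoid isolating a chosen endpoint of each of them. *)
Lemma card_rectangle r (q : gate D * gate D) : wire q.1 q.2 -> 16 * r <= t.+1 ->
  16 ^ r * #|[set b | rectangle g (cover_assign b) q]| <=
  15 ^ r * 2 ^ #|{: T * bool}|.
Proof.
move=> wq rt; set Rq := [set b | _].
have [->|[b1]] := set_0Vmem Rq; first by rewrite cards0 muln0.
rewrite inE => /andP[/(rectangle_mix dnnfD g_inj wq)/(_ T2)[s bal_s mix_s] _].
pose A := [set i | g i \in s]; pose B := [set i | x_ (i, true) \in s].
have /andP[A1 A2] := bal_s.
have [k] := exists_crossing_matching B A1 A2.
set M := [set i | _] => cardM.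
(* One endpoint of each crossing edge is never isolated in Rq: otherwise mixing
   two members of Rq would falsify the clause of that edge. *)
pose c i := if [forall b in Rq, (i, false) \notin isolated nbhd b]
            then (i, false) else (p k i, true).
have c_inj : injective c.
  by move=> i j; rewrite /c; case: ifP; case: ifP => // _ _ [] // /perm_inj.
have cP i : i \in M -> {in Rq, forall b, c i \notin isolated nbhd b}.
  rewrite inE /c => iM; case: ifP => [/forall_inP //|/negbT].
  rewrite negb_forall_in => /exists_inP[b0]; rewrite inE => Rb0; rewrite negbK.
  move=> ib0 b; rewrite inE => Rb; apply/negP => ib.
  have clash f : value D f -> f (g i) || f (x_ (p k i, true)).
    by rewrite eqD edge_cnf_value => /forallP/(_ (i, k)).
  have pkiB : (x_ (p k i, true) \in s) = (g i \notin s).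
    by move: iM; rewrite !inE; case: (g i \in s); case: (_ \in s).
  (* The mixture must take the left endpoint from [b0] and the right one from [b]; the order of the
     arguments depends on which of the two lies in [s]. *)
  have [gi|gi] := boolP (g i \in s).
    have := clash _ (mix_s _ _ Rb0 Rb); rewrite /mix pkiB gi /=.
    by rewrite !cover_assignE ib0 ib.
  have := clash _ (mix_s _ _ Rb Rb0); rewrite /mix pkiB gi (negPf gi).
  by rewrite !cover_assignE ib0 ib.
have card_cM : 16 * r <= #|c @: M| by rewrite card_imset //; lia.
have := card_avoiding nbhd_refl nbhd_sym card_nbhd card_cM.
apply: leq_trans; rewrite leq_mul2l; apply/orP; right.
apply/subset_leq_card/subsetP => b Rb; apply/avoidingP => _ /imsetP[i iM ->].
by have := cP i iM b Rb; rewrite inE.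
Qed.

(** The rectangles of the wires cover all [2 ^ #|V|] vertex sets [b], with [V] the vertex set, and
    each holds at most a [(15/16)^r] fraction of them. *)
Lemma edge_dnnf_size r : 16 * r <= t.+1 -> 16 ^ r <= nnf_size D * 15 ^ r.
Proof.
move=> rt; have pos : 0 < 2 ^ #|{: T * bool}| by rewrite expn_gt0.
rewrite -(leq_pmul2r pos) -mulnA -sum_nat_const.
apply: (@leq_trans (16 ^ r * \sum_(q | wire q.1 q.2)
    #|[set b | rectangle g (cover_assign b) q]|)).
  rewrite leq_mul2l; apply/orP; right.
  apply: leq_trans (leq_card_bigcup _ _).
  rewrite -cardsT -card_powerset; apply/subset_leq_card/subsetP => b _.
  have [|q wq bq] := rectangle_cover (f := cover_assign b) g_inj (ltnW T2)
    heavy_edge_output; first by rewrite eqD value_cover_assign.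
  by apply/bigcupP; exists q; rewrite ?inE.
by rewrite big_distrr; apply: leq_sum => q wq; apply: card_rectangle.
Qed.

End LowerBound.
End BipartiteFormula.

(** * Choice of constants and the class of hard formulas *)

(** Bernoulli gives [(1 + 1/q)^q >= 2]; raise this to the power [m]. *)
Lemma leq_double_exp q m : 0 < q -> 2 ^ m * q ^ (q * m) <= q.+1 ^ (q * m).
Proof.
move=> q0; have bernoulli i : (q + i) * q ^ i <= q * q.+1 ^ i.
  elim: i => [|i IH]; first by rewrite addn0.
  rewrite !expnS; have : (q + i.+1) * q <= (q + i) * q.+1 by nia.
  move=> h; have := leq_mul h (leqnn (q ^ i)); nia.
rewrite !expnM -expnMn; case: m => // m; rewrite leq_exp2r //.
by rewrite -(leq_pmul2l q0); have := bernoulli q; nia.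
Qed.

Section Embedding.
Variables (X : countType) (infX : forall s : seq X, exists x : X, x \notin s).

Lemma exists_uniq_seq n : exists2 s : seq X, uniq s & size s = n.
Proof.
elim: n => [|n [s us sn]]; first by exists [::].
by have [x xs] := infX s; exists (x :: s); rewrite /= ?xs ?sn.
Qed.

Lemma exists_embedding (V : finType) : exists x_ : V -> X, injective x_.
Proof.
have [x0 _] := infX [::]; have [s us sV] := exists_uniq_seq #|V|.
exists (fun v => nth x0 s (enum_rank v)) => v w /eqP.
by rewrite nth_uniq ?sV ?ltn_ord // => /eqP /ord_inj/enum_rank_inj.
Qed.

(* With t = 16 * 15 * m, a rectangle is hit at 15 * m independent places, and
   (16 / 15) ^ 15 >= 2. *)
Lemma exists_hard_cnfs : exists2 c, 0 < c & forall m, 0 < m ->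
  exists F : cnf X,
    [/\ m <= nnf_size F <= c * m, 2 ^ m <= DNNF F,
        read_times 3 F, monotone F & is_kcnf 2 F].
Proof.
(* The size is at most [9 * #|T|], and [#|T| = 512 * 240 * m]. *)
exists (9 * (512 * 240)) => [|m m0]; first by rewrite !muln_gt0.
set t := 240 * m; set n := 512 * t.
have n0 : 0 < n by rewrite /n /t; lia.
pose T : finType := 'I_n; have cT : #|T| = 512 * t by rewrite card_ord.
have [p1 [p2 p12]] := exists_expander (ltac:(rewrite /t; lia) : 0 < t) cT.
have [x_ x_inj] := exists_embedding (T * bool)%type.
pose p (k : 'I_3) : {perm T} := nth 1%g [:: 1%g; p1; p2] k.
have p_expanding (A : {set T}) : #|T| <= 3 * #|A| -> 3 * #|A| <= 2 * #|T| ->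
    exists k, 2 * t < #|displaced (p k) A|.
  move=> A1 A2; case/orP: (p12 A A1 A2) => ?.
    by exists (inord 1); rewrite /p inordK.
  by exists (inord 2); rewrite /p inordK.
pose F := edge_cnf (Ordinal n0 : T) p x_.
exists F; split.
- have := edge_cnf_size_ge (Ordinal n0 : T) p x_inj.
  have := edge_cnf_size_le (Ordinal n0 : T) p x_.
  by rewrite -/F cT /t -!mulnA => -> ?; rewrite andbT; lia.
- have [D [dnnfD eqD <-]] := DNNF_attained F.
  have T2 : 2 < #|T| by rewrite cT /t; lia.
  have h15 : 16 * (15 * m) <= t.+1 by rewrite /t; lia.
  have := @edge_dnnf_size X T (Ordinal n0) p x_ x_inj t D (erefl _)
    p_expanding T2 dnnfD eqD _ h15.
  have : 2 ^ m * 15 ^ (15 * m) <= 16 ^ (15 * m) by apply: leq_double_exp.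
  have pos : 0 < 15 ^ (15 * m) by rewrite expn_gt0.
  by move=> h1 h2; rewrite -(leq_pmul2r pos); apply: leq_trans h1 h2.
- exact: edge_cnf_read3.
- exact: edge_cnf_monotone.
- exact: edge_cnf_is_2cnf.
Qed.

End Embedding.

Local Open Scope ring_scope.

Theorem theorem18 (R : realType) (X : countType)
    (infX : forall s : seq X, exists x : X, x \notin s) :
  exists (c : R) (CC : cnf X -> Prop),
    [/\ 0 < c,
        forall n : nat, exists2 F : cnf X, CC F & (n <= nnf_size F)%N,
        forall F : cnf X, CC F ->
          2 `^ (c * (nnf_size F)%:R) <= (DNNF F)%:R &
        forall F : cnf X, CC F ->
          [/\ read_times 3 F, monotone F & is_kcnf 2 F]].
Proof.
have [k k_gt0 hard] := exists_hard_cnfs infX.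
have k0 : 0 < k%:R :> R by rewrite ltr0n.
(* The class consists of all formulas of the required shape that satisfy the bound, so only the
   existence of arbitrarily large members needs proof. *)
exists k%:R^-1, (fun F : cnf X => 2 `^ (k%:R^-1 * (nnf_size F)%:R) <= (DNNF F)%:R :> R /\
  [/\ read_times 3 F, monotone F & is_kcnf 2 F]).
split=> [|n|F []//|F []//]; first by rewrite invr_gt0.
(* The successor keeps the parameter positive; the size is at most [k * n.+1], so the exponent
   [nnf_size F / k] is at most [n.+1]. *)
have [F [/andP[size_ge size_le] dnnf_ge F_read F_mon F_2cnf]] :=
  hard n.+1 (ltn0Sn n).
exists F; last exact: ltnW.
split=> //; apply: (@le_trans _ _ (2 `^ n.+1%:R)).
  apply: ler_powR; first by rewrite ler1n.
  by rewrite mulrC ler_pdivrMr // -natrM ler_nat mulnC.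
by rewrite powR_mulrn // -natrX ler_nat.
Qed.
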